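(* Let $X$ and $Y$ be finite dimensional real normed spaces, $K\subset Y$ a proper convex cone, $L\subset S_X$ a nonempty closed set and $F:X\rightrightarrows Y$ a set-valued map. Suppose that $(\overline{x},\overline{y})\in\operatorname{Gr}F$ is a local directional Pareto minimum point for $F$ with respect to $L$, that $\operatorname{cone}L$ is convex, that $u\in\operatorname{int}K\cap S_Y$, and that the set-valued map $\mathcal{E}_F:X\rightrightarrows Y$, $\mathcal{E}_F(x):=F(x)+K$, has closed graph and is Lipschitz-like around $(\overline{x},\overline{y})$. Then there exist $x^*\in X^*$, $y^*\in K^+$ with $x^*(\ell)\ge0$ for all $\ell\in L$, $y^*(u)=1$ and $$x^*\in D^*\mathcal{E}_F(\overline{x},\overline{y})(y^* ).$$
   Context: $S_X,S_Y$ are the unit spheres; $\operatorname{cone}C=\{tc\mid t\ge0,\ c\in C\}$; $\operatorname{Gr}F=\{(x,y)\mid y\in F(x)\}$; $F(S)=\bigcup_{x\in S}F(x)$. A convex cone $K$ is proper if $K\neq\{0\}$ and $K\neq Y$ (not necessarily pointed). $K^+=\{y^*\in Y^*\mid y^*(y)\ge0\ \forall y\in K\}$. Products carry the sum norm. Local directional Pareto minimum (unconstrained): $(\overline{x},\overline{y})\in\operatorname{Gr}F$ is a local directional Pareto minimum point for $F$ with respect to $L$ if there is a neighborhood $U$ of $\overline{x}$ such that $\bigl(F(U\cap(\overline{x}+\operatorname{cone}L))-\overline{y}\bigr)\cap(-K)\subset K$. Lipschitz-like (Aubin property): $H:X\rightrightarrows Y$ is Lipschitz-like around $(\overline{x},\overline{y})\in\operatorname{Gr}H$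 if there are $\kappa\ge0$ and neighborhoods $U$ of $\overline{x}$, $V$ of $\overline{y}$ such that $H(x)\cap V\subset H(x')+\kappa\|x-x'\|D_Y$ for all $x,x'\in U$, where $D_Y$ is the closed unit ball. Normal cones and coderivative: for a nonempty subset $S$ of a Banach space $W$, $w\in S$ and $\varepsilon\ge0$, $\widehat{N}_\varepsilon(S,w)=\{w^*\in W^*\mid\limsup_{v\to w,\,v\in S}\frac{w^*(v-w)}{\|v-w\|}\le\varepsilon\}$. The Mordukhovich normal cone $N(S,\overline{w})$ is the set of $w^*$ for which there are $\varepsilon_n>0$, $\varepsilon_n\to0$, $w_n\to\overline{w}$ with $w_n\in S$, and $w_n^*\to w^*$ (weak$^*$) with $w_n^*\in\widehat{N}_{\varepsilon_n}(S,w_n)$ for all $n$. The Mordukhovich coderivative is $D^*H(\overline{x},\overline{y})(y^* )=\{x^*\in X^*\mid(x^*,-y^* )\in N(\operatorname{Gr}H,(\overline{x},\overline{y}))\}$. *)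

(* Defs.v *)
From HB Require Import structures.
From mathcomp Require Import all_boot all_order all_algebra.
From mathcomp Require Import all_classical all_reals all_analysis.

Set Implicit Arguments.
Unset Strict Implicit.
Unset Printing Implicit Defensive.

Import Order.TTheory GRing.Theory Num.Theory.
Import numFieldNormedType.Exports.

Local Open Scope classical_set_scope.
Local Open Scope ring_scope.

#[short(type="finDimNormedModType")]
HB.structure Definition FinDimNormedModule (R : numDomainType) :=
  {V of NormedModule R V & Vector R V}.

(* The library norms X * Y by the maximum of the two norms; sum_prod X Y is
   the same vector space with |(x, y)| = |x| + |y|. *)
Definition sum_prod (X Y : Type) : Type := (X * Y)%type.

Section SumNorm.
Context {R : numFieldType} {X Y : normedModType R}.

HB.instance Definition _ := GRing.Lmodule.copy (sum_prod X Y) (X * Y)%type.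

Definition sum_norm (z : sum_prod X Y) : R := `|z.1| + `|z.2|.

Lemma sum_normD (z t : sum_prod X Y) :
  sum_norm (z + t) <= sum_norm z + sum_norm t.
Proof. by rewrite /sum_norm addrACA lerD// ler_normD. Qed.

Lemma sum_normZ (l : R) (z : sum_prod X Y) :
  sum_norm (l *: z) = `|l| * sum_norm z.
Proof. by rewrite /sum_norm !normrZ mulrDr. Qed.

Lemma sum_norm_eq0 (z : sum_prod X Y) : sum_norm z = 0 -> z = 0.
Proof.
case: z => x y /eqP; rewrite /sum_norm/= paddr_eq0// !normr_eq0.
by move=> /andP[/eqP-> /eqP->].
Qed.

HB.instance Definition _ := Lmodule_isNormed.Build R (sum_prod X Y)
  sum_normD sum_normZ sum_norm_eq0.

End SumNorm.

Section Cones.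
Context {R : realType} {V : normedModType R}.
Implicit Types C K L : set V.

Definition unit_sphere : set V := [set x | `|x| = 1].

Definition cone C : set V := [set t *: c | t in [set t : R | 0 <= t] & c in C].

Definition proper_convex_cone K : Prop :=
  [/\ K !=set0,
      forall (t : R) (y : V), 0 <= t -> K y -> K (t *: y),
      @convex_set R V K,
      K <> [set 0] &
      K <> setT].

(* The topological dual, as a set of functions. *)
Definition dual : set (V -> R^o) := [set f | linear f /\ continuous f].

Definition dual_cone K : set (V -> R^o) :=
  [set f | dual f /\ forall y, K y -> 0 <= f y].

(* The difference quotient is taken over v in S with v != w; the limit superior
   is extended-real valued, equal to -oo when w is isolated in S. *)
Definition eps_normals (S : set V) (w : V) (eps : R) : set (V -> R^o) :=
  [set f | dual f /\
    (limf_esup (fun v => ((f (v - w) : R) / `|v - w|)%:E) (within S w^')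
       <= eps%:E)%E].

Definition normal_cone (S : set V) (w : V) : set (V -> R^o) :=
  [set f | dual f /\
    exists (eps : nat -> R) (wn : nat -> V) (fn : nat -> V -> R^o),
      [/\ (forall n, 0 < eps n) /\ eps @ \oo --> (0 : R),
          (forall n, S (wn n)) /\ wn @ \oo --> w,
          (forall v, (fun n => fn n v) @ \oo --> f v) &
          forall n, eps_normals S (wn n) (eps n) (fn n)]].

End Cones.

Section SetValuedMaps.
Context {R : realType} {X Y : normedModType R}.
Implicit Types (F H : X -> set Y) (L : set X) (K : set Y).

Definition graph F : set (sum_prod X Y) := [set z | F z.1 z.2].

Definition set_map_image F (S : set X) : set Y := \bigcup_(x in S) F x.

Definition epi_map F K : X -> set Y :=
  fun x => [set y + k | y in F x & k in K].

Definition local_directional_pareto_min F L K (x0 : X) (y0 : Y) : Prop :=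
  graph F (x0, y0) /\
  exists2 U : set X, nbhs x0 U &
    [set y - y0 | y in set_map_image F (U `&` [set x0 + h | h in cone L])]
      `&` [set - k | k in K] `<=` K.

Definition lipschitz_like H (x0 : X) (y0 : Y) : Prop :=
  graph H (x0, y0) /\
  exists (kappa : R) (U : set X) (V : set Y),
    [/\ 0 <= kappa, nbhs x0 U, nbhs y0 V &
        forall x x', U x -> U x' ->
          H x `&` V `<=`
          [set y + (kappa * `|x - x'|) *: d
             | y in H x' & d in [set d : Y | `|d| <= 1]]].

Definition coderivative H (x0 : X) (y0 : Y) (ys : Y -> R^o) :
    set (X -> R^o) :=
  [set xs | dual xs /\
    normal_cone (graph H) (x0, y0)
      (fun z : sum_prod X Y => xs z.1 - ys z.2)].

End SetValuedMaps.

(* Main.v *)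
(** The graph of E = epi_map F K, translated to the origin, is extremal with respect
to the cone (cone L) x (-K): Pareto minimality and u in int K keep it at distance
>= r e, near the origin, from the cone shifted by -e (0, u).  Choose inner products
on X and Y, put e = s^2, and minimise the square |p|^2 of the residual
p = (x - c, y + k + e u) plus the localising term e |(x, y)|^2, over (x, y) in the
graph, c in the closure of cone L and k in the closure of K.  At a minimiser -p is
normal to the graph up to an error of order s^3, and p lies in the polar of
(cone L) x (-K).  The Lipschitz property bounds |p1| by a multiple of |p2| + s^3,
while extremality gives r s^2 <= |p2| + kap |p1|.  Hence |p2| is at least of order
s^2, which dominates the error, and p2 can be normalised by <p2, u> >= r |p2|.  The
normalised functionals are bounded; a cluster point as s tends to 0 is the required
pair of multipliers. *)

Require Import Defs.
From HB Require Import structures.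
From mathcomp Require Import all_boot all_order all_algebra.
From mathcomp Require Import all_classical all_reals all_analysis.
From mathcomp Require Import ring lra.
Set Implicit Arguments.
Unset Strict Implicit.
Unset Printing Implicit Defensive.

Import Order.TTheory GRing.Theory Num.Theory.
Import numFieldNormedType.Exports.
Import VectorInternalTheory.
Local Open Scope classical_set_scope.
Local Open Scope ring_scope.

(** * Coordinates: norm equivalence and compactness of closed balls *)

Lemma row_entry_le_norm (R : realType) (n : nat) (w : 'rV[R]_n) (j : 'I_n) :
  `|w ord0 j| <= `|w|.
Proof.
rewrite [leRHS]/Num.norm /= mx_normrE.
by apply/bigmax_geP; right; exists (ord0, j).
Qed.

Lemma r2v_norm_le (R : realType) (V : finDimNormedModType R) :
  exists2 A : R, 0 < A &
    forall w : 'rV[R]_(dim V), `|r2v w : V| <= A * `|w|.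
Proof.
pose S : R := \sum_j `|r2v (delta_mx ord0 j : 'rV[R]_(dim V)) : V|.
have S0 : 0 <= S by apply: sumr_ge0 => j _; exact: normr_ge0.
exists (S + 1); first by rewrite ltr_pwDr.
move=> w; apply: (@le_trans _ _ (S * `|w|)); last first.
  by rewrite ler_wpM2r// lerDl.
rewrite {1}(row_sum_delta w) linear_sum /= mulr_suml.
apply: (le_trans (ler_norm_sum _ _ _)); apply: ler_sum => j _.
by rewrite linearZ /= normrZ mulrC ler_wpM2l// row_entry_le_norm.
Qed.

Lemma r2v_continuous (R : realType) (V : finDimNormedModType R) :
  continuous (r2v : 'rV[R]_(dim V) -> V).
Proof.
have [A A0 hA] := r2v_norm_le V.
move=> w; have FW : Filter (nbhs w) by exact: nbhs_filter.
apply/cvgrPdist_lt => /= e e0.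
have /cvgrPdist_lt : v @[v --> w] --> w by exact: cvg_id.
move=> /(_ (e / A)); rewrite divr_gt0// => /(_ isT); apply: filterS => v wv.
by rewrite -linearB (le_lt_trans (hA _))// mulrC -ltr_pdivlMr.
Qed.

(** The sphere of the row space is compact, so [|r2v w|] attains a minimum on it, which is positive
    because [r2v] is injective. Homogeneity turns the inverse of this minimum into the constant. *)
Lemma v2r_norm_le (R : realType) (V : finDimNormedModType R) :
  exists2 A : R, 0 < A & forall v : V, `|v2r v| <= A * `|v|.
Proof.
pose S : set 'rV[R]_(dim V) := [set w | `|w| = 1].
have cN : continuous (fun w : 'rV[R]_(dim V) => `|w|) by exact: norm_continuous.
have cS : compact S.
  apply: bounded_closed_compact.
    by exists 1; split => // M M1 w; rewrite /S/= => ->; exact: ltW.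
  rewrite (_ : S = (fun w => `|w|) @^-1` [set 1]) //.
  by apply: preimage_closed => [w _|]; [exact: cN|exact: closed_eq].
(* If the sphere is empty, the dimension is zero and every row vanishes, so any constant serves. *)
have [[w0 Sw0]|/set0P/negP/negPn/eqP S0] := pselect (S !=set0); last first.
  exists 1 => // v; suff -> : v2r v = 0 by rewrite normr0 mul1r.
  apply/eqP; rewrite -normr_eq0; apply: contraPT (S0) => v0.
  apply/eqP/set0P; exists (`|v2r v|^-1 *: v2r v).
  by rewrite /S /= normrZ normfV normr_id mulVf.
have cf : {within S, continuous (fun w : 'rV[R]_(dim V) => `|r2v w : V|)}.
  apply: continuous_subspaceT => w.
  by apply: continuous_comp; [exact: r2v_continuous|exact: norm_continuous].
have [w Sw hw] := compact_EVT_min (ex_intro _ _ Sw0) cS cf.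
have m0 : 0 < `|r2v w : V|.
  rewrite normr_gt0; apply/eqP => r0; have : w = 0.
    by apply: r2v_inj; rewrite r0 linear0.
  move: Sw; rewrite inE /S/= => w1 w0'; move: w1; rewrite w0' normr0.
  by move/eqP; rewrite eq_sym oner_eq0.
exists (`|r2v w : V|^-1); first by rewrite invr_gt0.
move=> v; have [->|v0] := eqVneq (v2r v) 0; first by rewrite normr0 mulr_ge0// invr_ge0.
have v0' : 0 < `|v2r v| by rewrite normr_gt0.
have := hw (`|v2r v|^-1 *: v2r v).
rewrite inE /S /= normrZ normfV normr_id mulVf ?gt_eqF// => /(_ erefl).
rewrite linearZ /= v2rK normrZ normfV normr_id.
rewrite -(ler_pM2l v0') mulrA mulfV ?gt_eqF// mul1r => le_v.
by rewrite mulrC ler_pdivlMr.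
Qed.

Lemma closed_norm_le (R : realType) (V : normedModType R) (r : R) :
  closed [set v : V | `|v| <= r].
Proof.
rewrite (_ : [set v : V | `|v| <= r] = (fun v : V => `|v|) @^-1` [set x | x <= r]) //.
by apply: preimage_closed; [move=> w _; exact: norm_continuous|exact: closed_le].
Qed.

(** The ball is a closed subset of the continuous image under [r2v] of a compact ball of rows. *)
Lemma closed_bounded_compact (R : realType) (V : finDimNormedModType R) (r : R) :
  compact [set v : V | `|v| <= r].
Proof.
have [A A0 hA] := v2r_norm_le V.
have cK : compact [set w : 'rV[R]_(dim V) | `|w| <= A * r].
  apply: bounded_closed_compact.
    exists (A * r); split; first by rewrite num_real.
    by move=> M M1 w /= hw; rewrite (le_trans hw)// ltW.
  exact: closed_norm_le.
have cI := continuous_compact (continuous_subspaceT (@r2v_continuous R V)) cK.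
apply: (subclosed_compact _ cI).
  exact: closed_norm_le.
move=> v /= vr; exists (v2r v); last exact: v2rK.
by rewrite /= (le_trans (hA v))// ler_pM2l.
Qed.

(** * Auxiliary inner products comparable with the given norms *)

Record is_inner (R : realType) (V : normedModType R) (a b : R)
    (B : V -> V -> R) : Prop := IsInner {
  innerC : forall v w, B v w = B w v;
  innerD : forall v v' w, B (v + v') w = B v w + B v' w;
  innerZ : forall t v w, B (t *: v) w = t * B v w;
  inner_ge : forall v, a * `|v| ^+ 2 <= B v v;
  inner_le : forall v w, `|B v w| <= b * `|v| * `|w| }.

(** A multiple of the coordinate dot product. The lower constant [a] is left to the caller, who
    needs a large one on X; the upper constant [b] is whatever results. *)
Lemma inner_exists (R : realType) (V : finDimNormedModType R) (a : R) :
  0 <= a -> exists (b : R) (B : V -> V -> R), 0 < b /\ is_inner a b B.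
Proof.
move=> a0; have [A A0 hA] := r2v_norm_le V.
have [A' A'0 hA'] := v2r_norm_le V.
pose a' := a * A ^+ 2.
have a'0 : 0 <= a' by rewrite mulr_ge0// exprn_ge0// ltW.
pose B (v w : V) : R := a' * \sum_j v2r v ord0 j * v2r w ord0 j.
(* Each of the [dim V] products is at most [A' ^+ 2 * (|v| * |w|)]. The added 1 keeps the constant
   positive when [a] or the dimension is zero. *)
exists (a' * (dim V)%:R * A' ^+ 2 + 1), B; split.
  by rewrite ltr_wpDl// mulr_ge0// ?exprn_ge0// ?mulr_ge0// ltW.
split.
- by move=> v w; rewrite /B; congr (_ * _); apply: eq_bigr => j _; rewrite mulrC.
- move=> v v' w; rewrite /B -mulrDr -big_split /=; congr (_ * _).
  by apply: eq_bigr => j _; rewrite linearD /= mxE mulrDl.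
- move=> t v w; rewrite /B [RHS]mulrCA; congr (_ * _); rewrite mulr_sumr.
  by apply: eq_bigr => j _; rewrite linearZ /= mxE mulrA.
- move=> v; rewrite /B /a' -mulrA ler_wpM2l//.
  apply: (@le_trans _ _ (A ^+ 2 * `|v2r v| ^+ 2)).
    rewrite -exprMn lerXn2r ?nnegrE//; first by rewrite mulr_ge0// ltW.
    by have := hA (v2r v); rewrite v2rK.
  rewrite ler_wpM2l//; first exact/exprn_ge0/ltW.
  have nn j : 0 <= v2r v ord0 j * v2r v ord0 j by rewrite -expr2 sqr_ge0.
  have [->|v0] := eqVneq (v2r v) 0.
    by rewrite normr0 expr0n /=; apply: sumr_ge0 => j _; rewrite mxE mulr0.
  (* The maximum norm of a nonzero row is attained at some entry, and the square of this entry is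
     one term of a sum of nonnegative terms. *)
  have /mx_norm_neq0[[i j]] : mx_norm (v2r v) != 0 by rewrite -[mx_norm _]/`|v2r v| normr_eq0.
  rewrite -[mx_norm _]/`|v2r v| /= (ord1 i) => ->.
  rewrite real_normK ?num_real// (bigD1 j)//= expr2 lerDl.
  by apply: sumr_ge0.
- move=> v w; rewrite /B normrM (ger0_norm a'0).
  apply: (@le_trans _ _ (a' * (\sum_(j < dim V) A' ^+ 2 * (`|v| * `|w|)))).
    rewrite ler_wpM2l//; apply: (le_trans (ler_norm_sum _ _ _)).
    apply: ler_sum => j _; rewrite normrM expr2 mulrACA.
    by apply: ler_pM => //; apply: (le_trans (row_entry_le_norm _ _)).
  rewrite sumr_const card_ord -[_ *+ dim V]mulr_natl !mulrA -subr_ge0.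
  rewrite -!mulrBl; apply: mulr_ge0 => //; apply: mulr_ge0 => //.
  by rewrite addrAC subrr add0r ler01.
Qed.

Lemma innerDr (R : realType) (V : normedModType R) (a b : R) (B : V -> V -> R)
    (hB : is_inner a b B) (v w w' : V) : B v (w + w') = B v w + B v w'.
Proof. by rewrite (innerC hB) (innerD hB) !(innerC hB v). Qed.

Lemma innerZr (R : realType) (V : normedModType R) (a b : R) (B : V -> V -> R)
    (hB : is_inner a b B) (t : R) (v w : V) : B v (t *: w) = t * B v w.
Proof. by rewrite (innerC hB) (innerZ hB) (innerC hB v). Qed.

Lemma innerN (R : realType) (V : normedModType R) (a b : R) (B : V -> V -> R)
    (hB : is_inner a b B) (v w : V) : B (- v) w = - B v w.
Proof. by rewrite -scaleN1r (innerZ hB) mulN1r. Qed.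

Lemma innerNr (R : realType) (V : normedModType R) (a b : R) (B : V -> V -> R)
    (hB : is_inner a b B) (v w : V) : B v (- w) = - B v w.
Proof. by rewrite -scaleN1r (innerZr hB) mulN1r. Qed.

Lemma inner_sqrD (R : realType) (V : normedModType R) (a b : R) (B : V -> V -> R)
    (hB : is_inner a b B) (v w : V) :
  B (v + w) (v + w) = B v v + 2 * B v w + B w w.
Proof. by rewrite (innerD hB) !(innerDr hB) (innerC hB w v); ring. Qed.

Lemma inner_continuous (R : realType) (V : normedModType R) (a b : R)
    (B : V -> V -> R) (hB : is_inner a b B) (b0 : 0 < b) (q : V) :
  continuous (fun v => B q v : R^o).
Proof.
move=> v; apply/cvgrPdist_lt => /= e e0.
have /cvgrPdist_lt : w @[w --> v] --> v by exact: cvg_id.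
have c0 : 0 < b * (`|q| + 1) by rewrite mulr_gt0// ltr_wpDl.
move=> /(_ (e / (b * (`|q| + 1)))); rewrite divr_gt0// => /(_ isT).
apply: filterS => w; rewrite ltr_pdivlMr// => vw.
rewrite -(innerNr hB) -(innerDr hB) (le_lt_trans (inner_le hB _ _))//.
by apply: le_lt_trans vw; rewrite [leRHS]mulrC ler_wpM2r// ler_pM2l// lerDl.
Qed.

Lemma inner_sqr_continuous (R : realType) (V : normedModType R) (a b : R)
    (B : V -> V -> R) (hB : is_inner a b B) (b0 : 0 < b) :
  continuous (fun v => B v v : R^o).
Proof.
move=> v; apply/cvgrPdist_lt => /= e e0.
have /cvgrPdist_lt vv : w @[w --> v] --> v by exact: cvg_id.
have c0 : 0 < b * (`|v| *+ 2 + 1) by rewrite mulr_gt0// ltr_wpDl// mulrn_wge0.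
have := vv (e / (b * (`|v| *+ 2 + 1))); rewrite divr_gt0// => /(_ isT).
have := vv 1; rewrite ltr01 => /(_ isT); apply: filterS2 => w vw1.
rewrite ltr_pdivlMr// => vw.
have -> : B v v - B w w = B (v - w) (v + w).
  rewrite (innerD hB) !(innerDr hB) !(innerN hB) (innerC hB w v); ring.
rewrite (le_lt_trans (inner_le hB _ _))//; apply: le_lt_trans vw.
rewrite [leRHS]mulrA [_ * b]mulrC ler_wpM2l//; first by rewrite mulr_ge0// ltW.
have -> : v + w = v *+ 2 - (v - w) by rewrite mulr2n opprB [w - v]addrC addrA addrK.
rewrite (le_trans (ler_normB _ _))// lerD//; [by rewrite normrMn|exact: ltW].
Qed.

(** * Existence of minimisers of the penalised problem *)

Section PenaltyMinimizer.
Context {R : realType} {X Y : finDimNormedModType R}.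
Variables (H : X -> Y -> Prop) (C : set X) (K : set Y).
Variables (BX : X -> X -> R) (BY : Y -> Y -> R) (aX bX aY bY : R).

Definition penalty (eps : R) (e : Y) (x : X) (y : Y) (c : X) (k : Y) : R :=
  BX (x - c) (x - c) + BY (y + k + e) (y + k + e) + eps * BX x x + eps * BY y y.

(** Coercivity: the terms weighted by [eps > 0] control x and y, and the two residuals then control
    c and k. A minimum over a large compact box is therefore global. *)
Lemma penalty_minimizer (eps : R) (e : Y) :
  0 < eps -> closed [set z : X * Y | H z.1 z.2] -> closed C -> closed K ->
  H 0 0 -> C 0 -> K 0 ->
  1 <= aX -> 1 <= aY -> 0 < bX -> 0 < bY ->
  is_inner aX bX BX -> is_inner aY bY BY ->
  exists x y c k, [/\ H x y, C c, K k &
    forall x' y' c' k', H x' y' -> C c' -> K k' ->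
      penalty eps e x y c k <= penalty eps e x' y' c' k'].
Proof.
move=> eps0 cH cC cK H0 C0 K0 aX1 aY1 bX0 bY0 hX hY.
have geX v : `|v| ^+ 2 <= BX v v.
  by apply: le_trans (inner_ge hX v); rewrite ler_peMl// exprn_ge0.
have geY v : `|v| ^+ 2 <= BY v v.
  by apply: le_trans (inner_ge hY v); rewrite ler_peMl// exprn_ge0.
have nnX v : 0 <= BX v v by apply: le_trans (geX v); rewrite exprn_ge0.
have nnY v : 0 <= BY v v by apply: le_trans (geY v); rewrite exprn_ge0.
have BX0 : BX 0 0 = 0 by rewrite -[in LHS](scale0r 0) (innerZ hX) mul0r.
have BY0 : BY 0 0 = 0 by rewrite -[in LHS](scale0r 0) (innerZ hY) mul0r.
(* [v] is the penalty at the origin. [r] is the bound obtained below for [|k|] when the penalty is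
   less than [v]; the bounds for x, y and c are smaller. *)
pose v := BY e e; pose r := 2 + v / eps + v + `|e|.
have v0 : 0 <= v by exact: nnY.
have veps0 : 0 <= v / eps by rewrite divr_ge0// ltW.
have r0 : 0 <= r by rewrite !addr_ge0.
pose P : set ((X * Y) * (X * Y)) :=
  (([set x | `|x| <= r] `*` [set y | `|y| <= r]) `*`
   ([set x | `|x| <= r] `*` [set y | `|y| <= r])).
have cP : compact P.
  by do !apply: compact_setX; exact: closed_bounded_compact.
pose S : set ((X * Y) * (X * Y)) :=
  [set w | [/\ H w.1.1 w.1.2, C w.2.1 & K w.2.2]].
have cS : closed S.
  have -> : S = (fst @^-1` [set z : X * Y | H z.1 z.2]) `&`
     ((fst \o snd) @^-1` C `&` (snd \o snd) @^-1` K).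
    by rewrite eqEsubset; split=> [w [? ? ?]|w [? [? ?]]].
  apply: closedI; first by apply: preimage_closed => // w _; exact: cvg_fst.
  apply: closedI; apply: preimage_closed => // w _; apply: continuous_comp.
  - exact: cvg_snd.
  - exact: cvg_fst.
  - exact: cvg_snd.
  - exact: cvg_snd.
pose G (w : (X * Y) * (X * Y)) : R^o := penalty eps e w.1.1 w.1.2 w.2.1 w.2.2.
have cG : continuous G.
  have c11 : continuous (fun w : (X * Y) * (X * Y) => w.1.1).
    by move=> w; apply: continuous_comp; exact: cvg_fst.
  have c12 : continuous (fun w : (X * Y) * (X * Y) => w.1.2).
    by move=> w; apply: continuous_comp; [exact: cvg_fst|exact: cvg_snd].
  have c21 : continuous (fun w : (X * Y) * (X * Y) => w.2.1).
    by move=> w; apply: continuous_comp; [exact: cvg_snd|exact: cvg_fst].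
  have c22 : continuous (fun w : (X * Y) * (X * Y) => w.2.2).
    by move=> w; apply: continuous_comp; exact: cvg_snd.
  have qX := inner_sqr_continuous hX bX0.
  have qY := inner_sqr_continuous hY bY0.
  move=> w; rewrite /G /penalty; apply: cvgD; [apply: cvgD; [apply: cvgD|]|].
  - apply: (@continuous_comp _ _ _ (fun w : (X * Y) * (X * Y) => w.1.1 - w.2.1)
      (fun v => BX v v : R^o)); last exact: qX.
    by apply: cvgB; [exact: c11|exact: c21].
  - apply: (@continuous_comp _ _ _ (fun w : (X * Y) * (X * Y) => w.1.2 + w.2.2 + e)
      (fun v => BY v v : R^o)); last exact: qY.
    by apply: cvgD; [apply: cvgD; [exact: c12|exact: c22]|exact: cvg_cst].
  - apply: cvgM; first exact: cvg_cst.
    apply: (@continuous_comp _ _ _ (fun w : (X * Y) * (X * Y) => w.1.1)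
      (fun v => BX v v : R^o)); [exact: c11|exact: qX].
  - apply: cvgM; first exact: cvg_cst.
    apply: (@continuous_comp _ _ _ (fun w : (X * Y) * (X * Y) => w.1.2)
      (fun v => BY v v : R^o)); [exact: c12|exact: qY].
have A0 : (P `&` S) ((0, 0), (0, 0)) by do !split; rewrite /= ?normr0.
have [w Aw minw] := compact_EVT_min (ex_intro _ _ A0) (compact_closedI cP cS)
  (continuous_subspaceT cG).
have G0 : G ((0, 0), (0, 0)) = v.
  by rewrite /G /penalty /= subrr !add0r BX0 BY0 !mulr0 !addr0 add0r.
have Gw : G w <= v by rewrite -G0; apply: minw; exact/mem_set.
move: Aw; rewrite inE => -[_ [Hw Cw Kw]].
exists w.1.1, w.1.2, w.2.1, w.2.2; split=> // x y c k Hx Cc Kk.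
have [Pw|nPw] := pselect (P ((x, y), (c, k))).
  by apply: (minw ((x, y), (c, k))); exact/mem_set.
apply: (le_trans Gw); rewrite leNgt; apply/negP => lt_v; apply: nPw.
(* A crude bound that avoids square roots. *)
have sq_le (t z : R) : 0 <= t -> t ^+ 2 <= z -> t <= 1 + z.
  by move=> t0 tz; nra.
have xx := mulr_ge0 (ltW eps0) (nnX x).
have yy := mulr_ge0 (ltW eps0) (nnY y).
have xc := nnX (x - c); have yk := nnY (y + k + e).
rewrite /penalty in lt_v.
have nx : `|x| <= 1 + v / eps.
  apply: sq_le => //; apply: (le_trans (geX x)); rewrite ler_pdivlMr// mulrC; lra.
have ny : `|y| <= 1 + v / eps.
  apply: sq_le => //; apply: (le_trans (geY y)); rewrite ler_pdivlMr// mulrC; lra.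
have nxc : `|x - c| <= 1 + v.
  by apply: sq_le => //; apply: (le_trans (geX (x - c))); lra.
have nyk : `|y + k + e| <= 1 + v.
  by apply: sq_le => //; apply: (le_trans (geY (y + k + e))); lra.
have nc : `|c| <= `|x| + `|x - c|.
  by rewrite (le_trans _ (ler_normB x (x - c)))// subKr.
have nk : `|k| <= `|y + k + e| + `|e| + `|y|.
  have {1}-> : k = (y + k + e) - e - y by rewrite addrK addrC addKr.
  by rewrite (le_trans (ler_normB _ _))// lerD2r ler_normB.
by have := normr_ge0 e; do !split => /=; rewrite /r; lra.
Qed.

End PenaltyMinimizer.

(** * Closures and a first-order condition *)

Lemma closure_norm (R : realType) (V : normedModType R) (A : set V) (v : V) (d : R) :
  closure A v -> 0 < d -> exists2 a, A a & `|v - a| < d.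
Proof.
move=> Av d0; have [a [Aa]] := Av _ (nbhsx_ballx v d d0).
by rewrite -ball_normE /ball_ /= => va; exists a.
Qed.

Lemma closure_addr (R : realType) (V : normedModType R) (A : set V) (v w : V) :
  (forall a, A a -> A (a + w)) -> closure A v -> closure A (v + w).
Proof.
move=> Aw Av U nU.
have [a [Aa Ua]] : A `&` ((fun a => a + w) @^-1` U) !=set0.
  apply: Av; apply: (@continuousD _ _ _ id (cst w) v); first exact: cvg_id.
    exact: cvg_cst.
  exact: nU.
by exists (a + w); split => //; exact: Aw.
Qed.

(** Dividing by t and letting t tend to 0 would give the claim; the single value [t = g / (1 + |h|)]
    already contradicts [g > 0]. *)
Lemma quadratic_ge0_le0 (R : realType) (g h : R) :
  (forall t, 0 < t -> 0 <= - (2 * t * g) + t ^+ 2 * h) -> g <= 0.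
Proof.
move=> H; rewrite leNgt; apply/negP => g0.
have h1 : 0 < 1 + `|h| by rewrite ltr_wpDr.
have t0 : 0 < g / (1 + `|h|) by rewrite divr_gt0.
have := H _ t0; set t := g / (1 + `|h|) in t0 *.
have gE : g = t * (1 + `|h|) by rewrite /t divfK// gt_eqF.
have hh := ler_norm h.
rewrite gE; have tt : 0 < t ^+ 2 by rewrite exprn_gt0.
rewrite (_ : _ + _ = t ^+ 2 * (h - 2 * (1 + `|h|))); last by ring.
by rewrite pmulr_rge0//; lra.
Qed.

(** * Estimates on the residuals at a minimiser *)

Section Estimates.
Context {R : realType} {X Y : finDimNormedModType R}.
Variables (H : X -> Y -> Prop) (C : set X) (K : set Y) (u : Y).
Variables (BX : X -> X -> R) (BY : Y -> Y -> R) (bX bY kap rho r : R).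
(* The weight of BX absorbs the term bY kap^2 |p1|^2 of residual_fst_le. *)
Hypotheses (hX : is_inner (bY * kap ^+ 2 + 2) bX BX) (hY : is_inner 1 bY BY).
Hypotheses (bX0 : 0 < bX) (bY0 : 0 < bY) (kap0 : 0 <= kap).
Hypotheses (rho0 : 0 < rho) (r0 : 0 < r) (u1 : `|u| = 1).
Hypothesis lip : forall x x' y, `|x| < rho -> `|x'| < rho -> `|y| < rho ->
  H x y -> exists2 y', H x' y' & `|y' - y| <= kap * `|x - x'|.
(** Extremality, available only at points of the graph lying exactly above [C]. This is why
    [residual_ge] first moves the graph point with the help of [lip]. *)
Hypothesis far : forall x y k (e : R), C x -> `|x| < rho -> H x y -> K k -> 0 < e ->
  r * e <= `|y + k + e *: u|.
Hypotheses (H00 : H 0 0) (C00 : C 0) (K00 : K 0).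
Hypothesis Hclosed : closed [set z : X * Y | H z.1 z.2].
Hypothesis CD : forall (t : R) c c', 0 <= t -> C c -> C c' -> C (c + t *: c').
Hypothesis KD : forall (t : R) k k', 0 <= t -> K k -> K k' -> K (k + t *: k').
Hypothesis uK : forall v, `|v| <= r -> K (u + v).

(** [b1] replaces the square root of [bY], since [bY <= b1 ^+ 2]. [A] collects the coefficients of
    the errors in [residual_fst_le] that come from the localising terms. *)
Let b1 : R := 1 + bY.
Let A : R := 3 * bX * b1 + 2 * bY * b1 * kap + bY * kap ^+ 2 * b1.

Let aX1 : 1 <= bY * kap ^+ 2 + 2.
Proof. by have := mulr_ge0 (ltW bY0) (exprn_ge0 2 kap0); lra. Qed.

Let geX v : `|v| ^+ 2 <= BX v v.
Proof. by apply: le_trans (inner_ge hX v); rewrite ler_peMl// exprn_ge0. Qed.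

Let geY v : `|v| ^+ 2 <= BY v v.
Proof. by have := inner_ge hY v; rewrite mul1r. Qed.

Let leX v w : BX v w <= bX * `|v| * `|w|.
Proof. exact: le_trans (ler_norm _) (inner_le hX v w). Qed.

Let leY v w : BY v w <= bY * `|v| * `|w|.
Proof. exact: le_trans (ler_norm _) (inner_le hY v w). Qed.

Let A0 : 0 < A.
Proof.
have b10 : 0 < b1 by exact: addr_gt0.
rewrite /A ltr_pwDl//; last by rewrite !mulr_ge0 ?exprn_ge0// ltW.
by rewrite ltr_pwDl ?mulr_gt0// !mulr_ge0// ltW.
Qed.

Section Minimizer.
Variables (s : R) (x : X) (y : Y) (c : X) (k : Y).
Hypotheses (s0 : 0 < s) (s1 : s <= 1) (s_rho : 4 * b1 * s < rho).
Hypotheses (Hxy : H x y) (Cc : closure C c) (Kk : closure K k).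
Hypothesis min : forall x' y' c' k', H x' y' -> closure C c' -> closure K k' ->
  penalty BX BY (s ^+ 2) (s ^+ 2 *: u) x y c k <=
  penalty BX BY (s ^+ 2) (s ^+ 2 *: u) x' y' c' k'.

Let p1 := x - c.
Let p2 := y + k + s ^+ 2 *: u.

Let sq_le (t z : R) : 0 <= z -> t ^+ 2 <= bY * z ^+ 2 -> t <= b1 * z.
Proof.
move=> z0 tz; rewrite leNgt; apply/negP => lt; move: tz; apply/negP; rewrite -ltNge.
have b10 : 0 <= b1 by rewrite ltW// addr_gt0.
apply: (@le_lt_trans _ _ ((b1 * z) ^+ 2)).
  rewrite exprMn ler_wpM2r ?exprn_ge0//.
  by have := sqr_ge0 bY; have := bY0; rewrite /b1 !expr2; lra.
by rewrite ltr_pXn2r// nnegrE ?mulr_ge0// (le_trans _ (ltW lt))// mulr_ge0.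
Qed.

(** Comparison with the origin, where the penalty is at most [bY * s ^+ 4]. Dividing by the weight
    [s ^+ 2] bounds the squares of the norms of x and y by [bY * s ^+ 2]; the residual [p1] needs no
    division, only [s <= 1]. *)
Lemma penalty_near :
  [/\ `|x| <= b1 * s, `|y| <= b1 * s, `|p1| <= b1 * s & `|c| <= 2 * b1 * s].
Proof.
have := min H00 (subset_closure C00) (subset_closure K00).
have BX0 : BX 0 0 = 0 by rewrite -[in LHS](scale0r 0) (innerZ hX) mul0r.
have BY0 : BY 0 0 = 0 by rewrite -[in LHS](scale0r 0) (innerZ hY) mul0r.
rewrite /penalty subr0 !add0r BX0 BY0 !mulr0 !addr0 add0r -/p1 -/p2.
have e2 : BY (s ^+ 2 *: u) (s ^+ 2 *: u) <= s ^+ 2 * (bY * s ^+ 2).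
  have nsu : `|s ^+ 2 *: u| = s ^+ 2.
    by rewrite normrZ u1 mulr1 ger0_norm// exprn_ge0// ltW.
  by have := leY (s ^+ 2 *: u) (s ^+ 2 *: u); rewrite nsu -mulrA mulrCA.
have ss0 : 0 < s ^+ 2 by rewrite exprn_gt0.
have nn1 v : 0 <= BX v v by rewrite (le_trans _ (geX v))// exprn_ge0.
have nn2 v : 0 <= BY v v by rewrite (le_trans _ (geY v))// exprn_ge0.
have n1 := nn1 p1; have n2 := nn2 p2.
have n3 := mulr_ge0 (ltW ss0) (nn1 x); have n4 := mulr_ge0 (ltW ss0) (nn2 y).
move=> hmin.
have px : `|x| <= b1 * s.
  apply: sq_le; [exact: ltW|apply: (le_trans (geX x))].
  by rewrite -(ler_pM2l ss0); lra.
have py : `|y| <= b1 * s.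
  apply: sq_le; [exact: ltW|apply: (le_trans (geY y))].
  by rewrite -(ler_pM2l ss0); lra.
have pp : `|p1| <= b1 * s.
  apply: sq_le; [exact: ltW|apply: (le_trans (geX p1))].
  have : s ^+ 2 * (bY * s ^+ 2) <= bY * s ^+ 2.
    apply: ler_piMl; first by rewrite mulr_ge0// ltW.
    by rewrite expr_le1// ltW.
  lra.
split=> //; have -> : c = x - p1 by rewrite /p1 subKr.
by apply: (le_trans (ler_normB _ _)); lra.
Qed.

Let b10 : 0 < b1. Proof. exact: addr_gt0. Qed.

Let b1s : 0 < b1 * s. Proof. by rewrite mulr_gt0. Qed.

Let xrho : `|x| < rho.
Proof. by have [? _ _ _] := penalty_near; have := b1s; have := s_rho; lra. Qed.

Let yrho : `|y| < rho.
Proof. by have [_ ? _ _] := penalty_near; have := b1s; have := s_rho; lra. Qed.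

Let crho : `|c| < rho / 2.
Proof. by have [_ _ _ ?] := penalty_near; have := b1s; have := s_rho; lra. Qed.

Lemma residual_fst_le : `|p1| <= bY * kap * `|p2| + A * s ^+ 3.
Proof.
have [px py pp _] := penalty_near.
have crho' : `|c| < rho by have := crho; have := rho0; lra.
(* Compare with the point of the graph above c, whose first residual vanishes. *)
have [v Hcv vle] : exists2 v, H c (y + v) & `|v| <= kap * `|p1|.
  have [y' Hcy' le] := lip xrho crho' yrho Hxy.
  by exists (y' - y) => //; rewrite addrC subrK.
have := min Hcv Cc Kk; rewrite /penalty -/p1 -/p2 subrr.
have BX0 : BX 0 0 = 0 by rewrite -[in LHS](scale0r 0) (innerZ hX) mul0r.
rewrite BX0 (_ : y + v + k + _ = p2 + v); last by rewrite /p2 -!addrA (addrC v) -addrA.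
have -> : c = x + - p1 by rewrite /p1 opprB addrC subrK.
rewrite (inner_sqrD hY p2) (inner_sqrD hY y) (inner_sqrD hX x (- p1)).
rewrite (innerN hX) !(innerNr hX _ p1) opprK => hmin.
have kp0 : 0 <= kap * `|p1| by rewrite mulr_ge0.
have e1 : BY p2 v <= bY * kap * `|p2| * `|p1|.
  apply: (le_trans (leY _ _)).
  have := ler_wpM2l (mulr_ge0 (ltW bY0) (normr_ge0 p2)) vle; lra.
have e2 : BY v v <= bY * kap ^+ 2 * `|p1| ^+ 2.
  have vv : `|v| ^+ 2 <= kap ^+ 2 * `|p1| ^+ 2 by rewrite -exprMn lerXn2r ?nnegrE.
  by apply: (le_trans (leY _ _)); have := ler_wpM2l (ltW bY0) vv; lra.
have p1s : `|p1| * `|p1| <= b1 * s * `|p1| by rewrite ler_wpM2r.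
(* [BY v v] occurs twice: unweighted, where the quadratic bound [e2] is absorbed by the weight of
   [BX], and with the factor [s ^+ 2], where this bound, linear in [|p1|], gives an error of order
   [s ^+ 3]. *)
have e2' : BY v v <= bY * kap ^+ 2 * b1 * s * `|p1|.
  apply: (le_trans e2); rewrite expr2.
  have := ler_wpM2l (mulr_ge0 (ltW bY0) (exprn_ge0 2 kap0)) p1s; lra.
have e3 : BY y v <= bY * b1 * kap * s * `|p1|.
  apply: (le_trans (leY _ _)).
  have h1 := ler_wpM2l (mulr_ge0 (ltW bY0) (normr_ge0 y)) vle.
  have := ler_wpM2r (mulr_ge0 (ltW bY0) kp0) py; lra.
have e4 : - BX x p1 <= bX * b1 * s * `|p1|.
  rewrite -(innerNr hX); apply: (le_trans (leX _ _)); rewrite normrN.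
  have := ler_wpM2r (mulr_ge0 (ltW bX0) (normr_ge0 p1)) px; lra.
have e5 : BX p1 p1 <= bX * b1 * s * `|p1|.
  apply: (le_trans (leX _ _)).
  have := ler_wpM2l (ltW bX0) p1s; lra.
have ge := inner_ge hX p1.
have ss0 : 0 < s ^+ 2 by rewrite exprn_gt0.
have big : (2 * BY y v + BY v v) + (2 * - BX x p1 + BX p1 p1) <= A * s * `|p1|.
  by rewrite /A; lra.
have big2 := ler_wpM2l (ltW ss0) big.
have main : 2 * `|p1| ^+ 2 <= 2 * (bY * kap * `|p2| * `|p1|) + A * s ^+ 3 * `|p1|.
  have -> : A * s ^+ 3 * `|p1| = s ^+ 2 * (A * s * `|p1|) by rewrite !exprS expr0; ring.
  lra.
have As : 0 <= A * s ^+ 3 by rewrite mulr_ge0 ?(ltW A0)// exprn_ge0// ltW.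
have bkp : 0 <= bY * kap * `|p2| by rewrite !mulr_ge0// ltW.
have [->|p1n0] := eqVneq (`|p1|) 0; first lra.
have p1pos : 0 < `|p1| by rewrite lt_def p1n0 normr_ge0.
rewrite -(ler_pM2r p1pos); move: main; rewrite expr2.
have := mulr_ge0 As (normr_ge0 p1); lra.
Qed.

(** Approximate c and k by points c' and k' of [C] and [K], and move y to the graph above c'. Up to
    the approximation error this changes the second residual by at most [kap * |p1|], and [far]
    applies to the result. *)
Lemma residual_ge : r * s ^+ 2 <= `|p2| + kap * `|p1|.
Proof.
have kk : 0 < kap + 1 by rewrite ltr_wpDl.
(* The first bound keeps c' in the ball of radius [rho], as [|c| < rho / 2]; the second makes the
   total error [d' + kap * d'] at most d. *)
apply/ler_addgt0Pr => d d0; set d' := Num.min (rho / 2) (d / (kap + 1)).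
have d'0 : 0 < d' by rewrite /d' lt_min !divr_gt0.
have [c' C' cc'] := closure_norm Cc d'0.
have [k' K' kk'] := closure_norm Kk d'0.
have [d'1 d'2] : d' <= rho / 2 /\ d' * (kap + 1) <= d.
  by rewrite -ler_pdivlMr// /d' !ge_min !lexx orbT.
have c'rho : `|c'| < rho.
  rewrite (_ : c' = c - (c - c')); last by rewrite subKr.
  by rewrite (le_lt_trans (ler_normB _ _))//; have := crho; lra.
have [y' Hy' yy'] := lip xrho c'rho yrho Hxy.
have ss0 : 0 < s ^+ 2 by rewrite exprn_gt0.
apply: (le_trans (far C' c'rho Hy' K' ss0)).
have -> : y' + k' + s ^+ 2 *: u = p2 + (y' - y) - (k - k').
  have -> : p2 + (y' - y) = k + s ^+ 2 *: u + y'.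
    by rewrite /p2 -(addrA y) (addrC y) (addrC y') addrA addrK.
  by rewrite opprB -(addrA k) (addrC k) (addrC k') addrA addrK addrC addrA -(addrA y') addrC.
apply: (le_trans (ler_normB _ _)); have := ler_normD p2 (y' - y).
have xc' : `|x - c'| <= `|p1| + d'.
  have -> : x - c' = p1 + (c - c') by rewrite /p1 addrA subrK.
  by apply: (le_trans (ler_normD _ _)); lra.
have := ler_wpM2l kap0 xc'; lra.
Qed.

(** First-order optimality in c along the admissible ray [c + t *: c']; the next lemma does the same
    with k. *)
Lemma residual_fst_polar c' : C c' -> BX p1 c' <= 0.
Proof.
move=> Cc'; apply: (@quadratic_ge0_le0 _ _ (BX c' c')) => t t0.
have Ct : closure C (c + t *: c') by apply: closure_addr Cc => a Ca; exact/CD/Cc'/Ca/ltW.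
have := min Hxy Ct Kk; rewrite /penalty -/p1 opprD addrA -/p1.
rewrite (inner_sqrD hX p1 (- (t *: c'))) (innerN hX (t *: c')) !(innerNr hX _ (t *: c')).
by rewrite (innerZ hX) !(innerZr hX _ _ c'); lra.
Qed.

Lemma residual_snd_polar k' : K k' -> 0 <= BY p2 k'.
Proof.
move=> Kk'; rewrite -oppr_le0; apply: (@quadratic_ge0_le0 _ _ (BY k' k')) => t t0.
have Kt : closure K (k + t *: k') by apply: closure_addr Kk => a Ka; exact/KD/Kk'/Ka/ltW.
have := min Hxy Cc Kt; rewrite /penalty -/p1 -/p2.
rewrite (_ : y + (k + t *: k') + _ = p2 + t *: k'); last first.
  by rewrite /p2 (addrA y k) [LHS]addrAC.
by rewrite (inner_sqrD hY p2 (t *: k')) (innerZ hY) !(innerZr hY _ _ k'); lra.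
Qed.

(** The point of [K] at distance r from u in the direction opposite to [p2] pairs nonnegatively with
    [p2]. *)
Lemma residual_snd_u : r * `|p2| <= BY p2 u.
Proof.
have [->|p20] := eqVneq p2 0.
  by rewrite normr0 mulr0 -(scale0r (0 : Y)) (innerZ hY) mul0r.
have p2p : 0 < `|p2| by rewrite normr_gt0.
have : K (u + (- (r / `|p2|)) *: p2).
  by apply: uK; rewrite normrZ normrN normrM normfV normr_id divfK ?gt_eqF// gtr0_norm.
move=> /residual_snd_polar; rewrite (innerDr hY) (innerZr hY).
rewrite mulNr subr_ge0; apply: le_trans.
by rewrite -mulrA ler_pM2l// ler_pdivlMl// -expr2 geY.
Qed.

(** Optimality in (x, y) with c and k fixed. The squares of the increments give the quadratic
    remainder. The derivative of the localising term has order [s ^+ 2] times the norms of x and y,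
    hence [s ^+ 3] by [penalty_near]. *)
Lemma residual_normal x' y' : H x' y' ->
  - (BX p1 (x' - x) + BY p2 (y' - y)) <=
  (bX + bY) * (`|x' - x| + `|y' - y|) ^+ 2 +
  (bX + bY) * b1 * s ^+ 3 * (`|x' - x| + `|y' - y|).
Proof.
move=> H'; have [px py _ _] := penalty_near.
have := min H' Cc Kk; rewrite /penalty -/p1 -/p2.
set dx := x' - x; set dy := y' - y.
have -> : x' = x + dx by rewrite /dx addrC subrK.
have -> : y' = y + dy by rewrite /dy addrC subrK.
have -> : x + dx - c = p1 + dx by rewrite /p1 addrAC.
have -> : y + dy + k + s ^+ 2 *: u = p2 + dy.
  by rewrite /p2 (addrAC y dy) [LHS]addrAC.
rewrite (inner_sqrD hX p1 dx) (inner_sqrD hX x dx).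
rewrite (inner_sqrD hY p2 dy) (inner_sqrD hY y dy).
set a := `|dx|; set b := `|dy|.
have a0 : 0 <= a by exact: normr_ge0.
have b0 : 0 <= b by exact: normr_ge0.
have e1 : BX dx dx <= bX * a ^+ 2 by have := leX dx dx; rewrite -mulrA -expr2.
have e2 : BY dy dy <= bY * b ^+ 2 by have := leY dy dy; rewrite -mulrA -expr2.
have e3 : BX x dx <= bX * b1 * s * a.
  by apply: (le_trans (leX _ _)); rewrite ler_wpM2r// -mulrA ler_pM2l.
have e4 : BY y dy <= bY * b1 * s * b.
  by apply: (le_trans (leY _ _)); rewrite ler_wpM2r// -mulrA ler_pM2l.
have ss0 : 0 < s ^+ 2 by rewrite exprn_gt0.
have ss1 : s ^+ 2 <= 1 by rewrite expr_le1// ltW.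
have nn1 : 0 <= BX dx dx by rewrite (le_trans _ (geX _))// exprn_ge0.
have nn2 : 0 <= BY dy dy by rewrite (le_trans _ (geY _))// exprn_ge0.
have f1 := ler_piMl nn1 ss1; have f2 := ler_piMl nn2 ss1.
have f3 := ler_wpM2l (ltW ss0) e3; have f4 := ler_wpM2l (ltW ss0) e4.
have ab := mulr_ge0 a0 b0.
have g1 : bX * a ^+ 2 + bY * b ^+ 2 <= (bX + bY) * (a + b) ^+ 2.
  have := mulr_ge0 (ltW bX0) ab; have := mulr_ge0 (ltW bY0) ab.
  have := mulr_ge0 (ltW bX0) (exprn_ge0 2 b0).
  have := mulr_ge0 (ltW bY0) (exprn_ge0 2 a0).
  by rewrite !expr2; lra.
have g2 : s ^+ 2 * (bX * b1 * s * a) + s ^+ 2 * (bY * b1 * s * b) <=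
   (bX + bY) * b1 * s ^+ 3 * (a + b).
  have s3 : 0 <= b1 * s ^+ 3 by rewrite mulr_ge0 ?exprn_ge0 ?(ltW s0) ?(ltW b10).
  have := mulr_ge0 s3 (mulr_ge0 (ltW bX0) b0).
  have := mulr_ge0 s3 (mulr_ge0 (ltW bY0) a0).
  by rewrite !exprS expr0; lra.
lra.
Qed.

End Minimizer.


(** The multipliers are [- p1 / th] and [- p2 / th] with [th = BY p2 u]. Since [th] is at least of
    order [s ^+ 2], the normality error of order [s ^+ 3] becomes of order s. [M] is chosen before
    [eta], so that a cluster point can be taken. *)
Lemma approximate_normal : exists M : R, forall eta : R, 0 < eta ->
  exists x y q1 q2, [/\ H x y, `|x| < eta, `|y| < eta, `|q1| <= M & `|q2| <= M] /\
    [/\ forall c, C c -> 0 <= BX q1 c,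
        forall k, K k -> BY q2 k <= 0,
        BY q2 u = -1 &
        exists2 d : R, 0 < d & forall x' y', H x' y' ->
          `|x' - x| + `|y' - y| < d ->
          BX q1 (x' - x) + BY q2 (y' - y) <= eta * (`|x' - x| + `|y' - y|)].
Proof.
have b10 : 0 < b1 by exact: addr_gt0.
have bXY : 0 < bX + bY by exact: addr_gt0.
have bk0 : 0 <= bY * kap ^+ 2 by rewrite mulr_ge0 ?exprn_ge0// ltW.
(* [m] is the constant in [|p2| >= m * s ^+ 2]: insert [residual_fst_le] into [residual_ge] and
   spend half of [r * s ^+ 2] on the error [kap * A * s ^+ 3]. *)
have m0 : 0 < r / (2 * (1 + bY * kap ^+ 2)) by rewrite divr_gt0// mulr_gt0// ltr_pwDl.
set m := r / (2 * (1 + bY * kap ^+ 2)) in m0.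
have mE : 2 * ((1 + bY * kap ^+ 2) * m) = r.
  by rewrite /m; field; rewrite gt_eqF// ltr_pwDl.
clearbody m.
have M10 : 0 <= bY * kap + A / m.
  by rewrite addr_ge0// ?mulr_ge0// ?invr_ge0 ltW.
set M1 := bY * kap + A / m in M10.
(* From [s ^+ 3 <= s ^+ 2 <= |p2| / m] one gets [|p1| <= M1 * |p2|]. Division by [th >= r * |p2|]
   gives the bounds [M1 / r] and [1 / r]. *)
exists ((M1 + 1) / r) => eta eta0.
have kA : 0 < kap * A + 1 by rewrite ltr_wpDl// mulr_ge0// ltW.
have [s [s0 s1 s2 s3 [s4 s5]]] : exists s : R, [/\ 0 < s, s <= 1, 4 * b1 * s < rho,
    2 * (kap * A + 1) * s < r &
    b1 * s < eta /\ 2 * ((bX + bY) * b1) * s < eta * (r * m)].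
  have h1 : 0 < rho / (4 * b1) by rewrite divr_gt0// mulr_gt0.
  have h2 : 0 < r / (2 * (kap * A + 1)) by rewrite divr_gt0// mulr_gt0.
  have h3 : 0 < eta / b1 by rewrite divr_gt0.
  have bb : 0 < 2 * ((bX + bY) * b1) by rewrite !mulr_gt0.
  have h4 : 0 < eta * (r * m) / (2 * ((bX + bY) * b1)) by rewrite divr_gt0// !mulr_gt0.
  near (0 : R)^'+ => s; exists s; split; last split.
  - by near: s; exact: nbhs_right_gt.
  - by near: s; exact: nbhs_right_le.
  - by rewrite mulrC -ltr_pdivlMr ?mulr_gt0//; near: s; exact: nbhs_right_lt.
  - by rewrite mulrC -ltr_pdivlMr ?mulr_gt0//; near: s; exact: nbhs_right_lt.
  - by rewrite mulrC -ltr_pdivlMr//; near: s; exact: nbhs_right_lt.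
  - by rewrite mulrC -ltr_pdivlMr//; near: s; exact: nbhs_right_lt.
have ss0 : 0 < s ^+ 2 by rewrite exprn_gt0.
have [x [y [c [k [Hxy Cc Kk min]]]]] := penalty_minimizer (s ^+ 2 *: u) ss0 Hclosed
  (@closed_closure _ C) (@closed_closure _ K) H00 (subset_closure C00) (subset_closure K00)
  aX1 (lexx 1) bX0 bY0 hX hY.
have [px py _ _] := penalty_near s0 s1 min.
have p1le := residual_fst_le s0 s1 s2 Hxy Cc Kk min.
have pge := residual_ge s0 s1 s2 Hxy Cc Kk min.
have pC := residual_fst_polar Hxy Cc Kk min.
have pK := residual_snd_polar Hxy Cc Kk min.
have pu := residual_snd_u Hxy Cc Kk min.
have pN := residual_normal s0 s1 Cc Kk min.
set p1 := x - c in p1le pge pC pN; set p2 := y + k + _ in p1le pge pK pu pN.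
have p2ge : m * s ^+ 2 <= `|p2|.
  have e1 := ler_wpM2l kap0 p1le.
  have e2 : 2 * ((kap * A + 1) * s * s ^+ 2) <= r * s ^+ 2.
    rewrite (_ : 2 * _ = 2 * (kap * A + 1) * s * s ^+ 2); last by ring.
    by rewrite ler_pM2r// ltW.
  have e3 : 0 < s * s ^+ 2 by rewrite mulr_gt0.
  have kk : 0 < 1 + bY * kap ^+ 2 by rewrite ltr_pwDl.
  rewrite -(ler_pM2l kk).
  have e4 : 2 * ((1 + bY * kap ^+ 2) * (m * s ^+ 2)) = r * s ^+ 2.
    by rewrite (mulrA _ m) mulrA mE.
  have e5 : kap * (A * s ^+ 3) = kap * A * s * s ^+ 2 by ring.
  by lra.
have p1le' : `|p1| <= M1 * `|p2|.
  apply: (le_trans p1le); rewrite /M1 [leRHS]mulrDl lerD2l -(mulrA A) ler_wpM2l ?(ltW A0)//.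
  rewrite ler_pdivlMl// (le_trans _ p2ge)// ler_pM2l// exprS ler_piMl// ?(ltW ss0)//.
have p2p : 0 < `|p2| by apply: lt_le_trans p2ge; rewrite mulr_gt0.
have th0 : 0 < BY p2 u by apply: lt_le_trans pu; rewrite mulr_gt0.
set th := BY p2 u in pu th0.
exists x, y, (- th^-1 *: p1), (- th^-1 *: p2).
have rth : th^-1 * `|p2| <= r^-1 by rewrite ler_pdivrMl// ler_pdivlMr// mulrC.
have thge : r * m * s ^+ 2 <= th.
  by apply: le_trans pu; rewrite -mulrA ler_pM2l.
split; split=> //.
- exact: le_lt_trans s4.
- exact: le_lt_trans s4.
- rewrite normrZ normrN gtr0_norm ?invr_gt0//.
  apply: (@le_trans _ _ (M1 * (th^-1 * `|p2|))).
    by rewrite mulrCA ler_pM2l ?invr_gt0.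
  by apply: ler_pM => //; [rewrite mulr_ge0// invr_ge0 ltW|rewrite lerDl].
- rewrite normrZ normrN gtr0_norm ?invr_gt0//; apply: (le_trans rth).
  by rewrite ler_peMl ?invr_ge0 ?(ltW r0)// lerDr.
- by move=> c' /pC; rewrite (innerZ hX) mulNr -mulrN => ?; rewrite mulr_ge0 ?oppr_ge0// invr_ge0 ltW.
- by move=> k' /pK; rewrite (innerZ hY) mulNr oppr_le0 => ?; rewrite mulr_ge0// invr_ge0 ltW.
- by rewrite (innerZ hY) mulNr mulVf// gt_eqF.
(* On this ball the quadratic remainder takes at most half of [eta * th * n]; the last condition on
   s leaves the other half for the error of order [s ^+ 3]. *)
- exists (eta * th / (2 * (bX + bY))); first by rewrite divr_gt0// ?mulr_gt0.
  move=> x' y' /pN; rewrite (innerZ hX) (innerZ hY) -mulrDr mulNr -mulrN.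
  set n := `|x' - x| + `|y' - y| => hN nd.
  have n0 : 0 <= n by rewrite addr_ge0.
  rewrite ler_pdivrMl//; apply: (le_trans hN).
  rewrite ltr_pdivlMr ?mulr_gt0// in nd.
  have e1 : 2 * ((bX + bY) * n ^+ 2) <= eta * th * n.
    have -> : 2 * ((bX + bY) * n ^+ 2) = n * (2 * (bX + bY)) * n by ring.
    by rewrite ler_wpM2r// ltW.
  have e2 : 2 * ((bX + bY) * b1 * s ^+ 3) <= eta * th.
    have -> : 2 * ((bX + bY) * b1 * s ^+ 3) = 2 * ((bX + bY) * b1) * s * s ^+ 2 by ring.
    apply: (@le_trans _ _ (eta * (r * m) * s ^+ 2)); first by rewrite ler_pM2r// ltW.
    by rewrite -mulrA ler_pM2l.
  by have := ler_wpM2r n0 e2; lra.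
Unshelve. all: by end_near. Qed.

End Estimates.

(** * Tools for the limit: compactness, convex cones, normals in the sum norm, extremality *)

Lemma compact_approximation (R : realType) (V : normedModType R) (A : set V)
    (P : R -> V -> Prop) :
  compact A -> (forall e e' a, e <= e' -> P e a -> P e' a) ->
  (forall e, 0 < e -> exists2 a, A a & P e a) ->
  exists a : V, forall e, 0 < e -> exists2 a', `|a - a'| < e & P e a'.
Proof.
move=> cA Pmono Pex.
(* Monotonicity of [P] in e makes the sets of admissible points a filter base; any cluster point of
   the resulting filter serves. *)
pose F := filter_from [set e : R | 0 < e] (fun e => A `&` P e).
have FF : ProperFilter F.
  apply: filter_from_proper => [|e /Pex[a Aa Pa]]; last by exists a.
  apply: filter_from_filter; first by exists 1; exact: ltr01.
  move=> e e' /= e0 e'0; exists (Num.min e e'); first by rewrite /= lt_min e0.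
  move=> a [Aa Pa]; split; split=> //.
  - by apply: Pmono Pa; rewrite ge_min lexx.
  - by apply: Pmono Pa; rewrite ge_min lexx orbT.
have FA : F A by exists 1 => [|a []]; rewrite /= ?ltr01.
have [a [_ clFa]] := cA F FF FA.
exists a => e e0.
have Fe : F (A `&` P e) by exists e.
have [a' [[_ Pa'] aa']] := clFa _ _ Fe (nbhsx_ballx a e e0).
by exists a' => //; move: aa'; rewrite -ball_normE.
Qed.

(** The sum is [1 + t] times a convex combination of v and w. *)
Lemma convex_cone_add (R : realType) (V : normedModType R) (A : set V) :
  (forall (t : R) v, 0 <= t -> A v -> A (t *: v)) -> @convex_set R V A ->
  forall (t : R) v w, 0 <= t -> A v -> A w -> A (v + t *: w).
Proof.
move=> Az Ac t v w t0 Av Aw.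
have t1 : 0 < 1 + t by rewrite ltr_pwDl.
have p01 : (0 <= (1 + t)^-1 <= 1)%R.
  by rewrite invr_ge0 (ltW t1)/= invf_le1// lerDl.
have [p0 p1] := andP p01.
have h : A ((1 + t)^-1 *: v + (1 - (1 + t)^-1) *: w).
  exact: set_mem (Ac v w (Itv01 p0 p1) (mem_set Av) (mem_set Aw)).
have := Az _ _ (ltW t1) h.
rewrite scalerDr !scalerA mulfV ?gt_eqF// scale1r mulrBr mulr1 mulfV ?gt_eqF//.
by rewrite addrAC subrr add0r.
Qed.

Lemma near_dist_lt (R : realType) (V : normedModType R) (v : V) (e : R) :
  0 < e -> \forall w \near v, `|v - w| < e.
Proof. by move=> e0; have := nbhsx_ballx v e e0; rewrite -ball_normE. Qed.

(** Transfers componentwise convergence to the topology of the sum norm. *)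
Lemma sum_norm_cvg (R : realType) (X Y : normedModType R) (T : Type)
    (F : set_system T) (FF : Filter F) (f : T -> X) (g : T -> Y) (x : X) (y : Y) :
  f @ F --> x -> g @ F --> y ->
  (fun t => (f t, g t) : sum_prod X Y) @ F --> ((x, y) : sum_prod X Y).
Proof.
move=> /cvgrPdist_lt fx /cvgrPdist_lt gy; apply/cvgrPdist_lt => /= e e0.
have e20 : 0 < e / 2 by rewrite divr_gt0.
apply: filterS2 (fx _ e20) (gy _ e20) => t h1 h2.
by rewrite [ltLHS]/Num.norm /= /sum_norm /= (splitr e) ltrD.
Qed.

Lemma sum_dual (R : realType) (X Y : normedModType R) (f : X -> R^o) (g : Y -> R^o) :
  dual f -> dual g -> dual (fun z : sum_prod X Y => f z.1 + g z.2 : R^o).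
Proof.
move=> [lf cf] [lg cg]; split.
  move=> a z w /=; rewrite lf lg scalerDr addrACA //.
have norm1 (z w : sum_prod X Y) : `|z.1 - w.1| <= `|z - w|.
  by rewrite [leRHS]/Num.norm /= /sum_norm /= lerDl.
have norm2 (z w : sum_prod X Y) : `|z.2 - w.2| <= `|z - w|.
  by rewrite [leRHS]/Num.norm /= /sum_norm /= lerDr.
have c1 : continuous (fun z : sum_prod X Y => f z.1 : R^o).
  move=> z; have FW : Filter (nbhs z) by exact: nbhs_filter.
  apply: (@continuous_comp (sum_prod X Y) X R^o (fun z => z.1) f); last exact: cf.
  by apply/cvgrPdist_lt => e /(near_dist_lt z); apply: filterS => w; exact: le_lt_trans.
have c2 : continuous (fun z : sum_prod X Y => g z.2 : R^o).
  move=> z; have FW : Filter (nbhs z) by exact: nbhs_filter.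
  apply: (@continuous_comp (sum_prod X Y) Y R^o (fun z => z.2) g); last exact: cg.
  by apply/cvgrPdist_lt => e /(near_dist_lt z); apply: filterS => w; exact: le_lt_trans.
move=> z; have FW : Filter (nbhs z) by exact: nbhs_filter.
exact: (cvgD (c1 z) (c2 z)).
Qed.

Lemma inner_dual (R : realType) (V : normedModType R) (a b : R) (B : V -> V -> R)
    (hB : is_inner a b B) (b0 : 0 < b) (q : V) : dual (fun v => B q v : R^o).
Proof.
split; last exact: inner_continuous hB b0 q.
by move=> t v w; rewrite (innerDr hB) (innerZr hB).
Qed.

(** The limit superior is an infimum of suprema over neighbourhoods; the punctured ball of radius d
    alone gives the bound. *)
Lemma eps_normals_local (R : realType) (V : normedModType R) (S : set V) (w : V)
    (e d : R) (f : V -> R^o) : 0 < d -> dual f ->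
  (forall v, S v -> `|v - w| < d -> f (v - w) <= e * `|v - w|) ->
  eps_normals S w e f.
Proof.
move=> d0 df le_f; split => //; rewrite limf_esupE.
apply: ge_ereal_inf; exists (ereal_sup
  [set ((f (v - w) : R) / `|v - w|)%:E | v in [set v | [/\ S v, v != w & `|v - w| < d]]]).
  exists [set v | [/\ S v, v != w & `|v - w| < d]] => //.
  rewrite /dnbhs /within /=; apply: filterS (near_dist_lt w d0) => v wv vw Sv.
  by split=> //; rewrite distrC.
apply: ge_ereal_sup => _ [v [Sv vw vd] <-]; rewrite lee_fin.
by rewrite ler_pdivrMr ?le_f// normr_gt0 subr_eq0.
Qed.

(** Suppose that [y + k + e *: u] equals [e *: v] with [|v| < r]. Then [u - v] is in [K], hence so
    is [- y]. Minimality puts [f - y0] in [K], so y and then [v - u] lie in [K]. Thus [K] meets its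
    own interior's negative and is the whole space, contrary to properness. *)
Lemma pareto_far (R : realType) (X Y : normedModType R) (K : set Y) (L : set X)
    (F : X -> set Y) (x0 : X) (y0 u : Y) (r : R) :
  proper_convex_cone K -> (forall v, `|v| <= r -> K (u + v)) ->
  local_directional_pareto_min F L K x0 y0 ->
  exists2 U, nbhs x0 U & forall x y k (e : R), cone L x -> U (x0 + x) ->
    epi_map F K (x0 + x) (y0 + y) -> K k -> 0 < e -> r * e <= `|y + k + e *: u|.
Proof.
move=> [_ Kz Kc _ KT] uK [_ [U nU hmin]]; exists U => // x y k e Cx Ux.
move=> [f Ff [k1 Kk1 fk1]] Kk e0; rewrite leNgt; apply/negP => ve.
have KD := convex_cone_add Kz Kc.
have Kadd a b : K a -> K b -> K (a + b).
  by move=> Ka Kb; rewrite -[b]scale1r; exact: KD.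
set v := e^-1 *: (y + k + e *: u).
have vE : e *: v = y + k + e *: u by rewrite /v scalerA mulfV ?gt_eqF// scale1r.
have vr : `|v| < r.
  by rewrite /v normrZ gtr0_norm ?invr_gt0// ltr_pdivrMl// mulrC.
have Kuv : K (u - v) by apply: uK; rewrite normrN ltW.
have KNy : K (- y).
  have -> : - y = k + e *: (u - v).
    by rewrite scalerBr vE opprD (addrC (e *: u)) subrK opprD addrCA subrr addr0.
  exact: KD (ltW e0) Kk Kuv.
have fE : f - y0 = y - k1.
  by apply: (addIr k1); rewrite subrK addrAC fk1 addrAC subrr add0r.
have Kf : K (f - y0).
  apply: hmin; split.
    by exists f => //; exists (x0 + x) => //; split => //; exists x.
  by exists (k1 - y); [exact: Kadd|rewrite opprB fE].
have Ky : K y by rewrite -(subrK k1 y) -fE; exact: Kadd.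
have Kvu : K (v - u).
  have -> : v - u = e^-1 *: (y + k).
    by rewrite /v scalerDr [X in _ + X - _]scalerA mulVf ?gt_eqF// scale1r addrK.
  by apply: Kz; [rewrite invr_ge0 ltW|exact: Kadd].
(* Adding [v - u] to the ball around u gives a ball of radius r around v inside [K]. It contains
   [t *: z] for the small t below, and scaling back gives z. *)
apply: KT; rewrite eqEsubset; split=> // z _.
have z1 : 0 < `|z| + 1 by rewrite ltr_wpDl.
have t0 : 0 < (r - `|v|) / (`|z| + 1) by rewrite divr_gt0// subr_gt0.
set t := _ / _ in t0.
have Ktz : K (t *: z).
  have -> : t *: z = (v - u) + (u + (t *: z - v)).
    by rewrite addrA subrK addrC subrK.
  apply: Kadd Kvu (uK _ _); apply: (le_trans (ler_normB _ _)).
  rewrite -lerBrDr normrZ gtr0_norm// /t mulrAC ler_pdivrMr//.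
  by rewrite ler_pM2l ?subr_gt0// lerDl.
have -> : z = t^-1 *: (t *: z) by rewrite scalerA mulVf ?gt_eqF// scale1r.
by apply: Kz => //; rewrite invr_ge0 ltW.
Qed.

Lemma nbhs_translate (R : realType) (V : normedModType R) (A : set V) (v : V) :
  nbhs v A -> exists2 r : R, 0 < r & forall w, `|w| < r -> A (v + w).
Proof.
move=> /nbhs_ballP[r /= r0 sub]; exists r => // w wr; apply: sub.
by rewrite -ball_normE /ball_ /= opprD addrA subrr add0r normrN.
Qed.

Lemma cvg_harmonic_dist (R : realType) (V : normedModType R) (f : nat -> V) (v : V) :
  (forall n, `|v - f n| < n.+1%:R^-1) -> f @ \oo --> v.
Proof.
move=> fv; apply/cvgrPdist_lt => e e0; near=> n; apply: lt_trans (fv n) _.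
by near: n; exact: near_infty_natSinv_lt (PosNum e0).
Unshelve. all: by end_near. Qed.

Lemma inner_cvgl (R : realType) (V : normedModType R) (a b : R) (B : V -> V -> R)
    (hB : is_inner a b B) (b0 : 0 < b) (f : nat -> V) (q v : V) :
  f @ \oo --> q -> (fun n => B (f n) v : R^o) @ \oo --> (B q v : R^o).
Proof.
move=> fq; rewrite (innerC hB q) (_ : (fun n => _) = B v \o f).
  by apply: cvg_comp fq _; exact: (@inner_continuous _ _ _ _ _ hB b0 v q).
by apply/funext => n /=; rewrite (innerC hB).
Qed.

Lemma cvg_ge0 (R : realType) (f : nat -> R^o) (l : R^o) :
  (forall n, 0 <= f n) -> f @ \oo --> l -> 0 <= l.
Proof.
move=> f0 fl; apply: (closed_cvg (fun x : R^o => 0 <= x) _ _ _ fl).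
  exact: closed_ge.
exact: nearW.
Qed.

(** Closedness is assumed for the sum norm but needed in the product topology, where the compactness
    argument takes place. *)
Lemma graph_translate_closed (R : realType) (X Y : normedModType R) (E : X -> set Y)
    (x0 : X) (y0 : Y) : closed (graph E) ->
  closed [set z : X * Y | E (x0 + z.1) (y0 + z.2)].
Proof.
move=> cE; apply: (@preimage_closed _ (sum_prod X Y)
  (fun z : X * Y => (x0 + z.1, y0 + z.2)) (graph E)) => // z _.
have FW : Filter (nbhs z) by exact: nbhs_filter.
apply: sum_norm_cvg; apply: cvgD; try exact: cvg_cst.
- exact: cvg_fst.
- exact: cvg_snd.
Qed.

(** * Translation to the origin and passage to the limit *)

Unset Implicit Arguments.

Theorem theorem3p18 (R : realType) (X Y : finDimNormedModType R)
    (K : set Y) (hK : proper_convex_cone K)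
    (L : set X) (hL_sphere : L `<=` unit_sphere) (hL0 : L !=set0)
    (hL_closed : closed L)
    (F : X -> set Y) (xbar : X) (ybar : Y)
    (hmin : local_directional_pareto_min F L K xbar ybar)
    (hL_convex : @convex_set R X (cone L))
    (u : Y) (hu : (interior K `&` unit_sphere) u)
    (hE_closed : closed (graph (epi_map F K)))
    (hE_lip : lipschitz_like (epi_map F K) xbar ybar) :
  exists (xs : X -> R^o) (ys : Y -> R^o),
    [/\ dual xs,
        dual_cone K ys,
        forall l, L l -> 0 <= xs l,
        ys u = 1 &
        coderivative (epi_map F K) xbar ybar ys xs].
Proof.
have [K0 Kz Kconv _ _] := hK.
have [Ku u1] := hu.
have [r' r'0 uK'] := nbhs_translate Ku.
have [r r0 uK] : exists2 r : R, 0 < r & forall v, `|v| <= r -> K (u + v).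
  exists (r' / 2); first by rewrite divr_gt0.
  by move=> v vr; apply: uK'; lra.
have K00 : K 0 by have [k /(Kz 0 _ (lexx 0))] := K0; rewrite scale0r.
have KD := convex_cone_add Kz Kconv.
pose C := cone L.
have C00 : C 0 by have [l Ll] := hL0; exists 0 => //=; exists l; rewrite ?scale0r.
have Cz (t : R) c : 0 <= t -> C c -> C (t *: c).
  move=> t0 [t' /= t'0 [l Ll <-]]; exists (t * t'); first exact: mulr_ge0.
  by exists l; rewrite ?scalerA.
have CD := convex_cone_add Cz hL_convex.
have [E00 [kap [U [V [kap0 nU nV lip]]]]] := hE_lip.
have [U' nU' far] := pareto_far hK uK hmin.
have [rho rho0 [rhoU rhoU' rhoV]] : exists2 rho : R, 0 < rho &
    [/\ forall x, `|x| < rho -> U (xbar + x), forall x, `|x| < rho -> U' (xbar + x) &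
        forall y, `|y| < rho -> V (ybar + y)].
  have [r1 r10 h1] := nbhs_translate nU.
  have [r2 r20 h2] := nbhs_translate nU'.
  have [r3 r30 h3] := nbhs_translate nV.
  exists (Num.min r1 (Num.min r2 r3)); first by rewrite !lt_min r10 r20.
  split=> v; rewrite !lt_min => /and3P[v1 v2 v3]; [exact: h1|exact: h2|exact: h3].
(* The form on Y comes first, because the lower constant required on X involves [bY]. *)
have [bY [BY [bY0 hY]]] := inner_exists Y ler01.
have a0 : 0 <= bY * kap ^+ 2 + 2.
  by rewrite addr_ge0// mulr_ge0 ?exprn_ge0// ltW.
have [bX [BX [bX0 hX]]] := inner_exists X a0.
pose H x y := epi_map F K (xbar + x) (ybar + y).
have Hlip x x' y : `|x| < rho -> `|x'| < rho -> `|y| < rho ->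
    H x y -> exists2 y', H x' y' & `|y' - y| <= kap * `|x - x'|.
  move=> /rhoU Ux /rhoU Ux' /rhoV Vy Hxy.
  have [y' Hy' [d /= d1 yE]] := lip _ _ Ux Ux' _ (conj Hxy Vy).
  rewrite opprD addrACA subrr add0r in yE.
  exists (y' - ybar); first by rewrite /H (addrC ybar) subrK.
  rewrite -addrA -opprD -yE opprD addrA subrr add0r normrN normrZ ger0_norm ?mulr_ge0//.
  by rewrite ler_piMr// mulr_ge0.
have Hfar x y k (e : R) : C x -> `|x| < rho -> H x y -> K k -> 0 < e ->
    r * e <= `|y + k + e *: u|.
  by move=> Cx /rhoU'; exact: far.
have H00 : H 0 0 by rewrite /H !addr0.
have Hcl := graph_translate_closed (x0 := xbar) (y0 := ybar) hE_closed.
have [M hM] := approximate_normal hX hY bX0 bY0 kap0 rho0 r0 u1 Hlip Hfar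
  H00 C00 K00 Hcl CD KD uK.
(* One parameter e bounds both the distance of the base point to the origin and the normality error,
   so the property is monotone in e. *)
pose normal_at (e : R) x y (q : X * Y) := [/\ H x y, `|x| < e & `|y| < e] /\
  [/\ forall c, C c -> 0 <= BX q.1 c, forall k, K k -> BY q.2 k <= 0,
      BY q.2 u = -1 &
      exists2 d : R, 0 < d & forall x' y', H x' y' -> `|x' - x| + `|y' - y| < d ->
        BX q.1 (x' - x) + BY q.2 (y' - y) <= e * (`|x' - x| + `|y' - y|)].
have cA : compact ([set q1 : X | `|q1| <= M] `*` [set q2 : Y | `|q2| <= M]).
  by apply: compact_setX; exact: closed_bounded_compact.
have [||q hq] := @compact_approximation R _ _
    (fun e q => exists x y, normal_at e x y q) cA.
- move=> e e' q ee' [x [y [[Hxy xe ye] [qC qK qu [d d0 qN]]]]].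
  exists x, y; split; first by split=> //; exact: lt_le_trans ee'.
  split=> //; exists d => // x' y' H' nd; apply: (le_trans (qN _ _ H' nd)).
  by rewrite ler_wpM2r// addr_ge0.
- move=> e /hM[x [y [q1 [q2 [[Hxy xe ye q1M q2M] rest]]]]].
  by exists (q1, q2) => //; exists x, y.
have /choice[w hw] : forall n : nat, exists w : (X * Y) * (X * Y),
    `|q - w.2| < n.+1%:R^-1 /\ normal_at n.+1%:R^-1 w.1.1 w.1.2 w.2.
  move=> n; have n0 : 0 < n.+1%:R^-1 :> R by rewrite invr_gt0.
  by have [q' qq' [x [y hxy]]] := hq _ n0; exists ((x, y), q').
have q1_cvg : (fun n => (w n).2.1) @ \oo --> q.1.
  apply: cvg_harmonic_dist => n; apply: le_lt_trans (hw n).1.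
  by rewrite prod_normE /= le_max lexx.
have q2_cvg : (fun n => (w n).2.2) @ \oo --> q.2.
  apply: cvg_harmonic_dist => n; apply: le_lt_trans (hw n).1.
  by rewrite prod_normE /= le_max lexx orbT.
have BXq c := inner_cvgl hX bX0 (v := c) q1_cvg.
have BYq k := inner_cvgl hY bY0 (v := k) q2_cvg.
have dualN q2 : dual (fun y => - BY q2 y : R^o).
  have -> : (fun y => - BY q2 y) = BY (- q2) by apply/funext => y; rewrite (innerN hY).
  exact: inner_dual hY bY0 _.
have yu : - BY q.2 u = 1.
  have BYu n : BY (w n).2.2 u = -1 by have [_ [_ [_ _ ->]]] := hw n.
  have : (fun n => BY (w n).2.2 u : R^o) @ \oo --> (-1 : R^o).
    by under eq_fun do rewrite BYu; exact: cvg_cst.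
  by move=> /(cvg_unique (@Rhausdorff R) (BYq u)) ->; rewrite opprK.
(* The coderivative pairs [xs] with [- ys], so [ys] is minus the second component of the limiting
   normal. *)
exists (BX q.1), (fun y => - BY q.2 y); split=> //.
- exact: inner_dual hX bX0 _.
- split=> // k Kk; rewrite oppr_ge0 -oppr_ge0.
  apply: cvg_ge0 (cvgN (BYq k)) => n /=.
  by have [_ [_ [_ qK _ _]]] := hw n; rewrite oppr_ge0 qK.
- move=> l Ll; apply: cvg_ge0 (BXq l) => n /=.
  have [_ [_ [qC _ _ _]]] := hw n; apply: qC.
  by exists 1 => //=; exists l; rewrite ?scale1r.
split; first exact: inner_dual hX bX0 _.
have fE (q' : X * Y) : (fun z : sum_prod X Y => BX q'.1 z.1 - - BY q'.2 z.2 : R^o) =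
    (fun z => BX q'.1 z.1 + BY q'.2 z.2).
  by apply/funext => z; rewrite opprK.
rewrite fE.
have fdual (q' : X * Y) : dual (fun z : sum_prod X Y => BX q'.1 z.1 + BY q'.2 z.2 : R^o).
  by apply: (sum_dual (f := BX q'.1) (g := BY q'.2)); [exact: inner_dual hX bX0 _|
    exact: inner_dual hY bY0 _].
split; first exact: fdual.
(* The witnesses are the approximate normals at nearby graph points, translated back; weak-star
   convergence is pointwise and follows from that of the representing vectors. *)
exists (fun n => n.+1%:R^-1), (fun n => (xbar + (w n).1.1, ybar + (w n).1.2)),
  (fun n z => BX (w n).2.1 z.1 + BY (w n).2.2 z.2); split.
- by split; [move=> n; rewrite invr_gt0|exact: cvg_harmonic].
- split; first by move=> n; have [_ [[]]] := hw n.
  apply: sum_norm_cvg; apply: cvg_harmonic_dist => n.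
  + by rewrite opprD addrA subrr add0r normrN; have [_ [[]]] := hw n.
  + by rewrite opprD addrA subrr add0r normrN; have [_ [[]]] := hw n.
- by move=> z; apply: cvgD; [exact: BXq|exact: BYq].
- move=> n; have [_ [_ [_ _ _ [d d0 qN]]]] := hw n.
  apply: (eps_normals_local d0); first exact: fdual.
  move=> [x y] /= Exy; rewrite [`|_|]/Num.norm /= /sum_norm /=.
  have Hxy : H (x - xbar) (y - ybar) by rewrite /H !(addrC _ (_ - _)) !subrK.
  by rewrite !opprD !addrA; exact: qN.
Qed.
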